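(* Let both the plant graph $G_{\mathcal P}$ and the control graph $G_{\mathcal K}$ be complete graphs. If the design graph $G_{\mathcal C}$ is not equal to $G_{\mathcal P}$, then $r_{\mathcal P}(\Gamma)\ge 1+1/\epsilon^2$ for all $\Gamma\in\mathcal C$.
   Context: Fix integers $q\ge 1$ and $n_1,\dots,n_q\ge 1$, put $n=\sum_{i=1}^q n_i$, and fix a real $\epsilon>0$. Matrices $M\in\mathbb R^{n\times n}$ are partitioned into blocks $M_{ij}\in\mathbb R^{n_i\times n_j}$, $1\le i,j\le q$. Graphs are directed with vertex set $\{1,\dots,q\}$, possibly with self-loops. The adjacency matrix $S=(s_{ij})$ of $G=(\{1,\dots,q\},E)$ is $s_{ij}=1$ if $(j,i)\in E$ and $s_{ij}=0$ otherwise. The complete graph contains all edges $(i,j)$, including self-loops. Plants: given the plant graph $G_{\mathcal P}$ with adjacency matrix $S_{\mathcal P}$, let $\mathcal A(S_{\mathcal P})=\{A\in\mathbb R^{n\times n}: A_{ij}=0 \text{ whenever } (s_{\mathcal P})_{ij}=0\}$, and let $\mathcal B(\epsilon)$ be the set of diagonal $n\times n$ matrices with all diagonal entries $\ge\epsilon$. The set of plants is $\mathcal P=\mathcal A(S_{\mathcal P})\times\mathcal B(\epsilon)\times\mathbb R^n$; $P=(A,B,x_0)$ stands for the system $x(k+1)=Ax(k)+Bu(k)$, $x(0)=x_0$. Controllers: given the control graph $G_{\mathcal K}$ with adjacency matrix $S_{\mathcal K}$, let $\mathcal K=\{K\in\mathbb R^{n\times n}: K_{ij}=0 \text{ whenever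 } (s_{\mathcal K})_{ij}=0\}$ (so $\mathcal K=\mathbb R^{n\times n}$ for complete $G_{\mathcal K}$); $K$ acts by $u(k)=Kx(k)$. Cost: $J_P(K)=\sum_{k=1}^\infty x(k)^Tx(k)+\sum_{k=0}^\infty u(k)^Tu(k)\in[0,\infty]$, evaluated along the closed loop of $P$ with $u=Kx$. Design methods: a control design method is a map $\Gamma:\mathcal A(S_{\mathcal P})\times\mathcal B(\epsilon)\to\mathcal K$. Given a design graph $G_{\mathcal C}$ with adjacency matrix $S_{\mathcal C}$, $\mathcal C$ is the set of control design methods $\Gamma$ with structure $G_{\mathcal C}$, meaning that for each $i$ the block row $[\Gamma_{i1}\ \cdots\ \Gamma_{iq}]$ is a function only of $\{[A_{j1}\ \cdots\ A_{jq}],\,B_{jj}: (s_{\mathcal C})_{ij}\ne 0\}$. Competitive ratio: for each $P\in\mathcal P$ let $K^*(P)\in\mathcal K$ be an optimal controller, i.e. $J_P(K^*(P))\le J_P(K)$ for all $K\in\mathcal K$ (for complete $G_{\mathcal K}$ it exists: the linear quadratic regulator). Set $$r_{\mathcal P}(\Gamma)=\sup_{P=(A,B,x_0)\in\mathcal P}\frac{J_P(\Gamma(A,B))}{J_P(K^*(P))},$$ with the conventions $0/0=1$ and $c/0=\infty$ for $c>0$. *)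

(* Defs.v *)
From HB Require Import structures.
From mathcomp Require Import all_boot all_order all_algebra.
From mathcomp Require Import all_classical all_reals all_analysis.

Set Implicit Arguments.
Unset Strict Implicit.
Unset Printing Implicit Defensive.

Import Order.TTheory GRing.Theory Num.Theory.
Import numFieldNormedType.Exports.

Local Open Scope classical_set_scope.
Local Open Scope ring_scope.

(* A directed graph on 'I_q, possibly with self-loops, is its edge set. *)
Definition digraph (q : nat) := {set 'I_q * 'I_q}.

Definition complete_graph (q : nat) : digraph q := [set: 'I_q * 'I_q]%SET.

(* The index order is reversed: s_ij = 1 iff there is an edge from j to i. *)
Definition adjacency (q : nat) (G : digraph q) : 'M[nat]_q :=
  \matrix_(i, j) (if (j, i) \in G then 1%N else 0%N).

(* n x n matrices with n = \sum_i n_ i, blocks submxblock M i j of size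
   n_ i x n_ j. *)
Notation blockmx R n_ := 'M[R]_(\sum_i n_ i).
Notation blockcv R n_ := 'cV[R]_(\sum_i n_ i).

(* Used with S_P for the matrices A and with S_K for the gains K. *)
Definition structured (R : realType) (q : nat) (n_ : 'I_q -> nat)
    (S : 'M[nat]_q) : set (blockmx R n_) :=
  [set M | forall i j, S i j = 0%N -> submxblock M i j = 0].

Definition input_matrices (R : realType) (q : nat) (n_ : 'I_q -> nat)
    (eps : R) : set (blockmx R n_) :=
  [set B | is_diag_mx B /\ forall k, eps <= B k k].

Record plant (R : realType) (q : nat) (n_ : 'I_q -> nat) := Plant {
  plantA : blockmx R n_;
  plantB : blockmx R n_;
  plantx0 : blockcv R n_ }.

Definition plants (R : realType) (q : nat) (n_ : 'I_q -> nat)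
    (eps : R) (SP : 'M[nat]_q) : set (plant R n_) :=
  [set P | structured SP (plantA P) /\ input_matrices eps (plantB P)].

Fixpoint state (R : realType) (q : nat) (n_ : 'I_q -> nat)
    (P : plant R n_) (K : blockmx R n_) (k : nat) : blockcv R n_ :=
  if k is k'.+1 then
    plantA P *m state P K k' + plantB P *m (K *m state P K k')
  else plantx0 P.

Definition control (R : realType) (q : nat) (n_ : 'I_q -> nat)
    (P : plant R n_) (K : blockmx R n_) (k : nat) : blockcv R n_ :=
  K *m state P K k.

Definition sqnorm (R : realType) (m : nat) (v : 'cV[R]_m) : R :=
  (v^T *m v) 0 0.

Definition cost (R : realType) (q : nat) (n_ : 'I_q -> nat)
    (P : plant R n_) (K : blockmx R n_) : \bar R :=
  (\sum_(1 <= k <oo) (sqnorm (state P K k))%:E +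
   \sum_(0 <= k <oo) (sqnorm (control P K k))%:E)%E.

Definition optimal (R : realType) (q : nat) (n_ : 'I_q -> nat)
    (SK : 'M[nat]_q) (P : plant R n_) : set (blockmx R n_) :=
  [set K | structured SK K /\
           forall K', structured SK K' -> (cost P K <= cost P K')%E].

(* K^*(P): a chosen element of [optimal SK P] whenever that set is nonempty
   (in particular for a complete control graph); 0 is only a default value. *)
Definition optimal_controller (R : realType) (q : nat) (n_ : 'I_q -> nat)
    (SK : 'M[nat]_q) (P : plant R n_) : blockmx R n_ :=
  xget 0 (optimal SK P).

(* The maps A(S_P) x B(eps) -> K with structure S_C. A method is a function on
   all pairs of matrices whose values off A(S_P) x B(eps) are irrelevant.
   [submxcol A j] is the j-th block row [A_j1 ... A_jq] of A (A seen as a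
   column of blocks). *)
Definition design_methods (R : realType) (q : nat) (n_ : 'I_q -> nat)
    (eps : R) (SP SK SC : 'M[nat]_q) :
    set (blockmx R n_ -> blockmx R n_ -> blockmx R n_) :=
  [set Gamma |
    (forall A B, structured SP A -> input_matrices eps B ->
       structured SK (Gamma A B)) /\
    (forall i A B A' B',
       structured SP A -> input_matrices eps B ->
       structured SP A' -> input_matrices eps B' ->
       (forall j, SC i j != 0%N ->
          submxcol A j = submxcol A' j /\
          submxblock B j j = submxblock B' j j) ->
       submxcol (Gamma A B) i = submxcol (Gamma A' B') i)].

(* For c > 0 the library already has c / 0 = +oo, but 0 / 0 = 0 there. *)
Definition cost_ratio (R : realType) (c d : \bar R) : \bar R :=
  if d == 0%E then (if c == 0%E then 1%E else +oo%E) else (c / d)%E.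

Definition competitive_ratio (R : realType) (q : nat) (n_ : 'I_q -> nat)
    (eps : R) (SP SK : 'M[nat]_q)
    (Gamma : blockmx R n_ -> blockmx R n_ -> blockmx R n_) : \bar R :=
  ereal_sup
    [set cost_ratio (cost P (Gamma (plantA P) (plantB P)))
                    (cost P (optimal_controller SK P))
    | P in plants eps SP].

(* Main.v *)
(* Some block row i of Gamma is blind to some block row j of A. Take state
   coordinates a in block i and b in block j, B = eps I, A e_b = w e_a,
   A e_a = r e_b and x(0) = e_b. The first step gives x_a(1) = w + eps g with
   g = Gamma_ab independent of r. If x_a(1) <> 0, the second step costs at least
   r^2 x_a(1)^2 / (1 + eps^2), unbounded in r, while deadbeat control keeps the
   optimal cost below w^2 / eps^2. If x_a(1) = 0, then g = - w / eps costs at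
   least w^2 / eps^2, whereas for r = 0 the optimal cost is w^2 / (1 + eps^2).
   When i = j, take a = b and A e_a = w e_a: g is then independent of w, and the
   second step costs at least w^2 (w + eps g)^2 / (1 + eps^2), so let w -> oo.

   The ratio only makes sense once the optimum is known to exist for these
   plants. As A is a permutation matrix times a diagonal one, the Riccati
   equation has a diagonal solution, found coordinatewise as a fixed point. *)

Require Import Defs.
From HB Require Import structures.
From mathcomp Require Import all_boot all_order all_algebra.
From mathcomp Require Import all_classical all_reals all_analysis.
From mathcomp Require Import perm ring lra.

Set Implicit Arguments.
Unset Strict Implicit.
Unset Printing Implicit Defensive.

Import Order.TTheory GRing.Theory Num.Theory.
Import numFieldNormedType.Exports.

Local Open Scope classical_set_scope.
Local Open Scope ring_scope.

(** * Cost as a series of stage costs, and storage-function bounds *)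

Lemma sqnormE (R : realType) (m : nat) (v : 'cV[R]_m) :
  sqnorm v = \sum_k v k 0 ^+ 2.
Proof.
by rewrite /sqnorm mxE; apply: eq_bigr => k _; rewrite mxE expr2.
Qed.

Lemma sqnorm_ge0 (R : realType) (m : nat) (v : 'cV[R]_m) : 0 <= sqnorm v.
Proof. by rewrite sqnormE sumr_ge0 // => k _; exact: sqr_ge0. Qed.

Lemma sqr_le_sqnorm (R : realType) (m : nat) (v : 'cV[R]_m) k :
  v k 0 ^+ 2 <= sqnorm v.
Proof.
rewrite sqnormE (bigD1 k) //= lerDl sumr_ge0 // => l _; exact: sqr_ge0.
Qed.

(** Pairing [x(k+1)] with [u(k)] merges the two series of the cost, which start at 1 and at 0. *)
Definition stage_cost (R : realType) (q : nat) (n_ : 'I_q -> nat)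
    (P : plant R n_) (K : blockmx R n_) (k : nat) : R :=
  sqnorm (state P K k.+1) + sqnorm (control P K k).

Lemma stage_cost_ge0 (R : realType) (q : nat) (n_ : 'I_q -> nat)
    (P : plant R n_) K k : 0 <= stage_cost P K k.
Proof. by rewrite addr_ge0 ?sqnorm_ge0. Qed.

Lemma costE (R : realType) (q : nat) (n_ : 'I_q -> nat) (P : plant R n_) K :
  cost P K = (\sum_(0 <= k <oo) (stage_cost P K k)%:E)%E.
Proof.
rewrite /cost.
rewrite -(@nneseries_addn R (fun k => (sqnorm (state P K k))%:E)); last first.
  by move=> i; rewrite lee_fin sqnorm_ge0.
rewrite -nneseriesD => [|i _ _|i _ _]; rewrite ?lee_fin ?sqnorm_ge0 //.
by apply: eq_eseriesr => k _; rewrite addn1 -EFinD.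
Qed.

Lemma partial_cost_le (R : realType) (q : nat) (n_ : 'I_q -> nat)
    (P : plant R n_) K N :
  ((\sum_(0 <= k < N) stage_cost P K k)%:E <= cost P K)%E.
Proof.
rewrite costE -sumEFin; apply: nneseries_lim_ge => k _ _.
by rewrite lee_fin stage_cost_ge0.
Qed.

Lemma cost_le_partial (R : realType) (q : nat) (n_ : 'I_q -> nat)
    (P : plant R n_) K (c : R) :
  (forall N, \sum_(0 <= k < N) stage_cost P K k <= c) -> (cost P K <= c%:E)%E.
Proof.
move=> le_c; rewrite costE; apply: lime_le.
  by apply: is_cvg_nneseries => k _ _; rewrite lee_fin stage_cost_ge0.
by apply: nearW => N; rewrite sumEFin lee_fin.
Qed.

Lemma stage_le_cost (R : realType) (q : nat) (n_ : 'I_q -> nat)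
    (P : plant R n_) K k :
  ((stage_cost P K k)%:E <= cost P K)%E.
Proof.
apply: le_trans (partial_cost_le P K k.+1).
rewrite lee_fin big_nat_recr //= lerDr sumr_ge0 // => i _.
exact: stage_cost_ge0.
Qed.

Lemma coord_le_cost (R : realType) (q : nat) (n_ : 'I_q -> nat)
    (P : plant R n_) K k c :
  ((state P K k.+1 c 0 ^+ 2 + control P K k c 0 ^+ 2)%:E <= cost P K)%E.
Proof.
apply: le_trans (stage_le_cost P K k); rewrite lee_fin.
by rewrite lerD ?sqr_le_sqnorm.
Qed.

(* If the cost were below [V (plantx0 P)], then [V] would stay bounded away from
   0 along the trajectory, hence so would the stage cost. *)
Lemma storage_le_cost (R : realType) (q : nat) (n_ : 'I_q -> nat)
    (P : plant R n_) K (V : blockcv R n_ -> R) (M : R) :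
  0 < M -> (forall x, V x <= M * sqnorm x) ->
  (forall k, V (state P K k) <= stage_cost P K k + V (state P K k.+1)) ->
  ((V (plantx0 P))%:E <= cost P K)%E.
Proof.
move=> M_gt0 V_le V_step.
have V_sum N : V (plantx0 P) <=
    \sum_(0 <= k < N) stage_cost P K k + V (state P K N).
  elim: N => [|N IHN]; first by rewrite big_geq // add0r.
  rewrite big_nat_recr //= -addrA; apply: le_trans IHN _.
  by rewrite lerD2l V_step.
rewrite leNgt; apply/negP => cost_lt.
have cost_fin : cost P K \is a fin_num.
  rewrite ge0_fin_numE; first exact: lt_trans cost_lt (ltry _).
  apply: le_trans (stage_le_cost P K 0); by rewrite lee_fin stage_cost_ge0.
move: cost_lt; have := partial_cost_le P K; rewrite -(fineK cost_fin).
set c := fine _ => S_le; rewrite lte_fin => c_lt.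
have stage_ge k : (V (plantx0 P) - c) / M <= stage_cost P K k.
  rewrite ler_pdivrMr // mulrC lerBlDl.
  apply: le_trans (V_sum k.+1) _; apply: lerD; first by rewrite -lee_fin.
  apply: le_trans (V_le _) _; rewrite ler_pM2l // lerDl.
  exact: sqnorm_ge0.
have S_ge N : (V (plantx0 P) - c) / M *+ N <= c.
  rewrite -lee_fin; apply: le_trans (S_le N); rewrite lee_fin.
  have -> : (V (plantx0 P) - c) / M *+ N =
      \sum_(0 <= k < N) (V (plantx0 P) - c) / M.
    by rewrite sumr_const_nat subn0.
  by apply: ler_sum => k _; exact: stage_ge.
set d := (V _ - c) / M in S_ge.
have d_gt0 : 0 < d by rewrite divr_gt0 // subr_gt0.
have := S_ge (Num.bound (c / d)).
rewrite -mulr_natr -ler_pdivlMl // [d^-1 * c]mulrC.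
apply/negP; rewrite -ltNge.
have c_ge0 : 0 <= c by apply: le_trans (S_ge 0%N); rewrite mulr0n.
exact: archi_boundP (divr_ge0 c_ge0 (ltW d_gt0)).
Qed.

(** Dissipation inequality: the stage costs telescope against [V], and the last value of [V] is
    nonnegative. *)
Lemma cost_le_storage (R : realType) (q : nat) (n_ : 'I_q -> nat)
    (P : plant R n_) K (V : blockcv R n_ -> R) :
  (forall x, 0 <= V x) ->
  (forall k, stage_cost P K k + V (state P K k.+1) <= V (state P K k)) ->
  (cost P K <= (V (plantx0 P))%:E)%E.
Proof.
move=> V_ge0 V_step; apply: cost_le_partial => N.
suff: \sum_(0 <= k < N) stage_cost P K k + V (state P K N) <= V (plantx0 P).
  by apply: le_trans; rewrite lerDl.
elim: N => [|N IHN]; first by rewrite big_geq // add0r.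
rewrite big_nat_recr //= -addrA; apply: le_trans IHN.
by rewrite lerD2l V_step.
Qed.

(** * The scalar Riccati map and its fixed points *)

Definition riccati (R : realType) (eps d p : R) : R :=
  d ^+ 2 * (1 + p) / (1 + eps ^+ 2 * (1 + p)).

(** For [p >= 0], [(1 + p) * (d * x + eps * u) ^+ 2 + u ^+ 2] is minimal at
    [u = riccati_gain eps d p * x], with minimum [riccati eps d p * x ^+ 2]. The 1 charges the next
    state itself, [p] its cost-to-go. *)
Definition riccati_gain (R : realType) (eps d p : R) : R :=
  - (eps * (1 + p) * d / (1 + eps ^+ 2 * (1 + p))).

Lemma riccati_den_gt0 (R : realType) (eps p : R) :
  0 <= p -> 0 < 1 + eps ^+ 2 * (1 + p).
Proof. by move=> p_ge0; rewrite ltr_pwDl // mulr_ge0 ?sqr_ge0 ?addr_ge0. Qed.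

Lemma riccati_ge0 (R : realType) (eps d p : R) :
  0 <= p -> 0 <= riccati eps d p.
Proof.
move=> p_ge0; rewrite divr_ge0 ?(ltW (riccati_den_gt0 _ _)) //.
by rewrite mulr_ge0 ?sqr_ge0 ?addr_ge0.
Qed.

Lemma riccati_mono (R : realType) (eps d p p' : R) :
  0 <= p -> p <= p' -> riccati eps d p <= riccati eps d p'.
Proof.
move=> p_ge0 le_pp'; have p'_ge0 := le_trans p_ge0 le_pp'.
rewrite /riccati ler_pdivrMr ?riccati_den_gt0 // [leRHS]mulrAC.
rewrite ler_pdivlMr ?riccati_den_gt0 //.
rewrite -subr_ge0.
have -> : d ^+ 2 * (1 + p') * (1 + eps ^+ 2 * (1 + p)) -
  d ^+ 2 * (1 + p) * (1 + eps ^+ 2 * (1 + p')) = d ^+ 2 * (p' - p) by ring.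
by rewrite mulr_ge0 ?sqr_ge0 ?subr_ge0.
Qed.

(** The bound is the cost of the deadbeat input [u = - d * x / eps] at [x = 1], whatever [p] is. *)
Lemma riccati_le (R : realType) (eps d p : R) :
  0 < eps -> 0 <= p -> riccati eps d p <= d ^+ 2 / eps ^+ 2.
Proof.
move=> eps_gt0 p_ge0; have e2_gt0 : 0 < eps ^+ 2 by rewrite exprn_gt0.
rewrite ler_pdivrMr ?riccati_den_gt0 // [leRHS]mulrAC ler_pdivlMr //.
rewrite -subr_ge0.
have -> : d ^+ 2 * (1 + eps ^+ 2 * (1 + p)) - d ^+ 2 * (1 + p) * eps ^+ 2 =
  d ^+ 2 by ring.
exact: sqr_ge0.
Qed.

Lemma riccati_gt0 (R : realType) (eps d p : R) :
  d != 0 -> 0 <= p -> 0 < riccati eps d p.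
Proof.
move=> d_neq0 p_ge0; rewrite divr_gt0 ?riccati_den_gt0 //.
by rewrite mulr_gt0 ?exprn_even_gt0 //= ltr_pwDl.
Qed.

Lemma riccati_square (R : realType) (eps d p x u : R) : 0 <= p ->
  (1 + p) * (d * x + eps * u) ^+ 2 + u ^+ 2 =
  riccati eps d p * x ^+ 2 +
  (1 + eps ^+ 2 * (1 + p)) * (u - riccati_gain eps d p * x) ^+ 2.
Proof.
move=> p_ge0; have := lt0r_neq0 (riccati_den_gt0 eps p_ge0).
by move=> den_neq0; rewrite /riccati /riccati_gain; field.
Qed.

Lemma riccati_step (R : realType) (eps d p x u : R) : 0 <= p ->
  riccati eps d p * x ^+ 2 <= (1 + p) * (d * x + eps * u) ^+ 2 + u ^+ 2.
Proof.
move=> p_ge0; rewrite riccati_square // lerDl mulr_ge0 ?sqr_ge0 //.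
exact/ltW/riccati_den_gt0.
Qed.

(* Knaster-Tarski: the coordinatewise supremum of the subsolutions. *)
Lemma riccati_fixpoint (R : realType) (I : Type) (eps : R) (s : I -> I)
    (d : I -> R) : 0 < eps ->
  exists v : I -> R,
    (forall l, 0 <= v l) /\ (forall l, v l = riccati eps (d l) (v (s l))).
Proof.
move=> eps_gt0.
pose sub (v : I -> R) := forall l,
  0 <= v l /\ v l <= riccati eps (d l) (v (s l)).
pose E l := [set v l | v in sub].
have sub0 : sub (fun=> 0) by move=> l; split => //; exact: riccati_ge0.
have ubE l : ubound (E l) (d l ^+ 2 / eps ^+ 2).
  move=> _ [v sub_v <-]; have [_ /le_trans] := sub_v l; apply.
  by apply: riccati_le => //; have [] := sub_v (s l).
have supE l : has_sup (E l).
  by split; [exists 0; exists (fun=> 0) | exists (d l ^+ 2 / eps ^+ 2)].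
pose w l := sup (E l).
have le_w v l : sub v -> v l <= w l.
  by move=> sub_v; apply: sup_upper_bound => //; exists v.
have w_ge0 l : 0 <= w l := le_w (fun=> 0) l sub0.
have w_le l : w l <= riccati eps (d l) (w (s l)).
  apply: ge_sup; first by case: (supE l).
  move=> _ [v sub_v <-]; have [_ /le_trans] := sub_v l; apply.
  by apply: riccati_mono (le_w _ _ sub_v); have [] := sub_v (s l).
exists w; split=> // l; apply/eqP; rewrite eq_le w_le /=.
(* By monotonicity the Riccati image of [w] is again a subsolution, hence lies below [w]. *)
apply: (le_w (fun l => riccati eps (d l) (w (s l)))) => k; split.
  exact: riccati_ge0.
exact: riccati_mono.
Qed.

(** * Monomial plants and their optimal cost *)

Definition monomial_mx (R : realType) (m : nat) (s : {perm 'I_m})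
    (d : 'I_m -> R) : 'M[R]_m :=
  \matrix_(k, l) (if k == s l then d l else 0).

Lemma mul_monomial_mx (R : realType) (m : nat) (s : {perm 'I_m})
    (d : 'I_m -> R) (x : 'cV[R]_m) l :
  (monomial_mx s d *m x) (s l) 0 = d l * x l 0.
Proof.
rewrite mxE (bigD1 l) //= mxE eqxx big1 ?addr0 // => k k_neq.
by rewrite mxE (inj_eq perm_inj) eq_sym (negPf k_neq) mul0r.
Qed.

Definition monomial_plant (R : realType) (q : nat) (n_ : 'I_q -> nat)
    (eps : R) (s : {perm 'I_(\sum_i n_ i)}) (d : 'I_(\sum_i n_ i) -> R)
    (x0 : blockcv R n_) : plant R n_ :=
  Plant (monomial_mx s d) eps%:M x0.

Lemma state_monomial_plant (R : realType) (q : nat) (n_ : 'I_q -> nat)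
    (eps : R) (s : {perm 'I_(\sum_i n_ i)}) d (x0 : blockcv R n_) K k l :
  let P := monomial_plant eps s d x0 in
  state P K k.+1 (s l) 0 =
  d l * state P K k l 0 + eps * control P K k (s l) 0.
Proof. by rewrite /= mxE mul_monomial_mx mul_scalar_mx [in X in _ + X]mxE. Qed.

(** Reindexing by [s] groups [x_(s l)(k+1)] and [u_(s l)(k)] with [x_l(k)], which splits the problem
    into scalar ones. *)
Lemma stage_monomial_plant (R : realType) (q : nat) (n_ : 'I_q -> nat)
    (eps : R) (s : {perm 'I_(\sum_i n_ i)}) d (x0 : blockcv R n_) K k
    (v : 'I_(\sum_i n_ i) -> R) :
  let P := monomial_plant eps s d x0 in
  stage_cost P K k + \sum_l v l * state P K k.+1 l 0 ^+ 2 =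
  \sum_l ((1 + v (s l)) *
            (d l * state P K k l 0 + eps * control P K k (s l) 0) ^+ 2 +
          control P K k (s l) 0 ^+ 2).
Proof.
move=> P; rewrite /stage_cost !sqnormE addrAC -!big_split /=.
rewrite (reindex_inj (@perm_inj _ s)) /=; apply: eq_bigr => l _.
by rewrite -(state_monomial_plant eps s d x0 K k l) mulrDl mul1r.
Qed.

(** [V] bounds every cost from below by [riccati_step], and [K0] attains it because it makes the
    square in [riccati_square] vanish. *)
Lemma optimal_cost_monomial_plant (R : realType) (q : nat) (n_ : 'I_q -> nat)
    (eps : R) (s : {perm 'I_(\sum_i n_ i)}) d (x0 : blockcv R n_)
    (v : 'I_(\sum_i n_ i) -> R)
    (SK : 'M[nat]_q) :
  (forall i j, SK i j != 0%N) ->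
  (forall l, 0 <= v l) -> (forall l, v l = riccati eps (d l) (v (s l))) ->
  let P := monomial_plant eps s d x0 in
  cost P (optimal_controller SK P) = (\sum_l v l * x0 l 0 ^+ 2)%:E.
Proof.
move=> SK_complete v_ge0 v_fix P.
pose V (x : blockcv R n_) := \sum_l v l * x l 0 ^+ 2.
pose K0 : blockmx R n_ :=
  monomial_mx s (fun l => riccati_gain eps (d l) (v (s l))).
have V_le_cost K : ((V x0)%:E <= cost P K)%E.
  apply: (@storage_le_cost _ _ _ P K V (1 + \sum_l v l)).
  - by rewrite ltr_pwDl // sumr_ge0.
  - move=> x; rewrite mulrDl mul1r mulr_suml.
    apply: (@le_trans _ _ (\sum_l v l * sqnorm x)).
      by apply: ler_sum => l _; rewrite ler_wpM2l // sqr_le_sqnorm.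
    by rewrite lerDr sqnorm_ge0.
  - move=> k; rewrite stage_monomial_plant; apply: ler_sum => l _.
    by rewrite [v l]v_fix riccati_step.
have cost_le_V : (cost P K0 <= (V x0)%:E)%E.
  apply: (@cost_le_storage _ _ _ P K0 V).
    by move=> x; rewrite sumr_ge0 // => l _; rewrite mulr_ge0 ?sqr_ge0.
  move=> k; rewrite stage_monomial_plant; apply: ler_sum => l _.
  rewrite riccati_square // -v_fix /control mul_monomial_mx subrr.
  by rewrite expr0n mulr0 addr0.
have K0_optimal : optimal SK P K0.
  split=> [i j /eqP|K' _]; first by rewrite (negPf (SK_complete i j)).
  exact: le_trans cost_le_V (V_le_cost K').
(* As [K0] is optimal, [xget] returns an optimal controller and not merely its default 0. *)
have [_ Kopt_le] := xgetPex 0 (ex_intro _ _ K0_optimal).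
apply/eqP; rewrite eq_le; apply/andP; split=> //.
apply: le_trans cost_le_V; apply: Kopt_le.
by case: K0_optimal.
Qed.

(** * Lower bounds on the ratio for two-coordinate plants *)

Lemma cost_ratio_ge (R : realType) (c : R) (x : \bar R) (v : R) :
  0 < v -> ((c * v)%:E <= x)%E -> (c%:E <= cost_ratio x v%:E)%E.
Proof.
move=> v_gt0 le_x; rewrite /cost_ratio eqe gt_eqF //.
by rewrite inver gt_eqF // lee_pdivlMr.
Qed.

(** The Riccati step with [p = 0]: only [x_(s l)(2)] and [u_(s l)(1)] are charged, at the best
    [u_(s l)(1)]. *)
Lemma second_stage_le_cost (R : realType) (q : nat) (n_ : 'I_q -> nat)
    (eps : R) (s : {perm 'I_(\sum_i n_ i)}) d (x0 : blockcv R n_) K l :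
  ((d l ^+ 2 * state (monomial_plant eps s d x0) K 1 l 0 ^+ 2 /
      (1 + eps ^+ 2))%:E <= cost (monomial_plant eps s d x0) K)%E.
Proof.
set P := monomial_plant _ _ _ _.
apply: le_trans (coord_le_cost P K 1 (s l)); rewrite lee_fin.
rewrite state_monomial_plant.
have := riccati_step eps (d l) (state P K 1 l 0) (control P K 1 (s l) 0)
  (lexx (0 : R)).
by rewrite /riccati addr0 mul1r !mulr1 mulrAC.
Qed.

(* [A e_b = w e_a] and [A e_a = r e_b] with [x(0) = e_b]; for [a = b] this is
   [A e_a = w e_a], and [r] is ignored. *)
Definition swap_plant (R : realType) (q : nat) (n_ : 'I_q -> nat)
    (eps : R) (a b : 'I_(\sum_i n_ i)) (w r : R) : plant R n_ :=
  monomial_plant eps (tperm a b)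
    (fun l => if l == b then w else if l == a then r else 0) (delta_mx b 0).

Lemma control0_swap_plant (R : realType) (q : nat) (n_ : 'I_q -> nat)
    (eps : R) (a b : 'I_(\sum_i n_ i)) (w r : R) K c :
  control (swap_plant eps a b w r) K 0 c 0 = K c b.
Proof. by rewrite /control /= -colE mxE. Qed.

Lemma state1_swap_plant (R : realType) (q : nat) (n_ : 'I_q -> nat)
    (eps : R) (a b : 'I_(\sum_i n_ i)) (w r : R) K :
  state (swap_plant eps a b w r) K 1 a 0 = w + eps * K a b.
Proof.
rewrite -{2}(tpermR a b) state_monomial_plant tpermR control0_swap_plant.
by rewrite eqxx /= mxE !eqxx mulr1.
Qed.

(** From [e_b] the optimal cost is the Riccati fixed point at [b], and [p] is its value at [a]. If
    [a != b] and [r = 0], then [A] kills [e_a], whose cost-to-go is 0. *)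
Lemma optimal_cost_swap_plant (R : realType) (q : nat) (n_ : 'I_q -> nat)
    (eps : R) (a b : 'I_(\sum_i n_ i)) (w r : R) (SK : 'M[nat]_q) :
  (forall i j, SK i j != 0%N) -> 0 < eps ->
  exists p : R, [/\ 0 <= p, (a != b -> r = 0 -> p = 0) &
    let P := swap_plant eps a b w r in
    cost P (optimal_controller SK P) = (riccati eps w p)%:E].
Proof.
move=> SK_complete eps_gt0.
pose d l := if l == b then w else if l == a then r else 0.
have [v [v_ge0 v_fix]] := riccati_fixpoint (tperm a b) d eps_gt0.
exists (v a); split=> //.
  move=> a_neq_b r_eq0; rewrite v_fix /d (negPf a_neq_b) eqxx r_eq0.
  by rewrite /riccati expr0n !mul0r.
move=> P; rewrite (optimal_cost_monomial_plant _ SK_complete v_ge0 v_fix).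
congr (_%:E); rewrite (bigD1 b) //= [X in _ + X]big1 => [|l l_neq]; last first.
  by rewrite mxE (negPf l_neq) expr0n mulr0.
by rewrite mxE !eqxx expr1n mulr1 addr0 v_fix tpermR /d eqxx.
Qed.

(** The optimum is at most [w ^+ 2 / eps ^+ 2], while the second stage costs at least the right-hand
    side; [d] is the factor that [A] applies to coordinate [a]. *)
Lemma amplified_ratio_ge (R : realType) (q : nat) (n_ : 'I_q -> nat)
    (eps c : R) (a b : 'I_(\sum_i n_ i)) (w r : R) (SK : 'M[nat]_q)
    (K : blockmx R n_) :
  (forall i j, SK i j != 0%N) -> 0 < eps -> 0 <= c -> w != 0 ->
  let d := if a == b then w else r in
  c * (w ^+ 2 / eps ^+ 2) <= d ^+ 2 * (w + eps * K a b) ^+ 2 / (1 + eps ^+ 2) ->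
  (c%:E <= cost_ratio (cost (swap_plant eps a b w r) K)
     (cost (swap_plant eps a b w r)
        (optimal_controller SK (swap_plant eps a b w r))))%E.
Proof.
move=> SK_complete eps_gt0 c_ge0 w_neq0 d le_d.
have [p [p_ge0 _ ->]] := optimal_cost_swap_plant a b w r SK_complete eps_gt0.
apply: cost_ratio_ge; first exact: riccati_gt0.
apply: le_trans (second_stage_le_cost eps _ _ _ K a).
rewrite lee_fin state1_swap_plant eqxx.
by apply: le_trans le_d; rewrite ler_wpM2l // riccati_le.
Qed.

(** Cancelling [x_a(1)] forces the gain [- eps^-1], which costs at least [1 / eps ^+ 2]; the optimum
    is [1 / (1 + eps ^+ 2)], and the quotient is exactly the bound. *)
Lemma deadbeat_ratio_ge (R : realType) (q : nat) (n_ : 'I_q -> nat)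
    (eps : R) (a b : 'I_(\sum_i n_ i)) (SK : 'M[nat]_q)
    (K : blockmx R n_) :
  (forall i j, SK i j != 0%N) -> 0 < eps -> a != b -> 1 + eps * K a b = 0 ->
  ((1 + 1 / eps ^+ 2)%:E <= cost_ratio (cost (swap_plant eps a b 1 0) K)
     (cost (swap_plant eps a b 1 0)
        (optimal_controller SK (swap_plant eps a b 1 0))))%E.
Proof.
set P := swap_plant _ _ _ _ _ => SK_complete eps_gt0 a_neq_b deadbeat.
have [p [_ p_eq0 ->]] := optimal_cost_swap_plant a b 1 0 SK_complete eps_gt0.
rewrite p_eq0 //; apply: cost_ratio_ge.
  by apply: riccati_gt0; rewrite ?oner_neq0.
apply: le_trans (coord_le_cost P K 0 a); rewrite lee_fin.
rewrite state1_swap_plant control0_swap_plant deadbeat.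
have -> : K a b = - eps^-1.
  have := deadbeat; move/eqP; rewrite addrC addr_eq0 => /eqP eK.
  by rewrite -[LHS](mulKf (lt0r_neq0 eps_gt0)) eK mulrN1.
have den_neq0 := lt0r_neq0 (riccati_den_gt0 eps (lexx 0)).
rewrite le_eqVlt; apply/orP; left; apply/eqP.
rewrite /riccati; field; rewrite lt0r_neq0 //=.
by move: den_neq0; rewrite addr0 mulr1.
Qed.

(** * Rows hidden from the design method *)

Lemma swap_plantA_row (R : realType) (q : nat) (n_ : 'I_q -> nat)
    (eps : R) (a b : 'I_(\sum_i n_ i)) (w r r' : R) k l : k != b ->
  plantA (swap_plant eps a b w r) k l = plantA (swap_plant eps a b w r') k l.
Proof.
(* [r] can only occur in column [a], whose only possibly nonzero entry is in row [b]. *)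
move=> k_neq; rewrite !mxE; case: eqP => // k_eq; case: (l =P b) => // _.
by case: (l =P a) => // l_eq; rewrite k_eq l_eq tpermL eqxx in k_neq.
Qed.

Lemma swap_plantA_row0 (R : realType) (q : nat) (n_ : 'I_q -> nat)
    (eps : R) (a b : 'I_(\sum_i n_ i)) (w r : R) k l :
  k != a -> k != b -> plantA (swap_plant eps a b w r) k l = 0.
Proof.
move=> k_neq_a k_neq_b; rewrite mxE; case: eqP => // k_eq.
case: eqP => [l_eq|_]; first by rewrite k_eq l_eq tpermR eqxx in k_neq_a.
by case: eqP => // l_eq; rewrite k_eq l_eq tpermL eqxx in k_neq_b.
Qed.

Lemma adjacency_complete (q : nat) i j :
  adjacency (complete_graph q) i j != 0%N.
Proof. by rewrite mxE inE. Qed.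

Lemma structured_complete (R : realType) (q : nat) (n_ : 'I_q -> nat)
    (S : 'M[nat]_q) (M : blockmx R n_) :
  (forall i j, S i j != 0%N) -> structured S M.
Proof. by move=> S_neq0 i j /eqP; rewrite (negPf (S_neq0 i j)). Qed.

Lemma scalar_input_matrix (R : realType) (q : nat) (n_ : 'I_q -> nat)
    (eps : R) : input_matrices eps (eps%:M : blockmx R n_).
Proof. by split=> [|k]; [exact: scalar_mx_is_diag | rewrite mxE eqxx]. Qed.

Lemma blind_row (R : realType) (q : nat) (n_ : 'I_q -> nat) (eps : R)
    (SP SK SC : 'M[nat]_q)
    (Gamma : blockmx R n_ -> blockmx R n_ -> blockmx R n_) i j :
  design_methods eps SP SK SC Gamma -> (forall i j, SP i j != 0%N) ->
  SC i j = 0%N ->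
  forall (A A' B : blockmx R n_), input_matrices eps B ->
  (forall j', j' != j -> forall k l,
     A (tagnat.Rank j' k) l = A' (tagnat.Rank j' k) l) ->
  forall k l, Gamma A B (tagnat.Rank i k) l = Gamma A' B (tagnat.Rank i k) l.
Proof.
move=> [_ Gamma_local] SP_complete SC_ij A A' B B_in eqA k l.
have SP_all M : structured SP (M : blockmx R n_) by exact: structured_complete.
have := Gamma_local i A B A' B (SP_all A) B_in (SP_all A') B_in.
move=> rowE; have /matrixP/(_ k l) : submxcol (Gamma A B) i =
    submxcol (Gamma A' B) i.
  apply: rowE => j' SC_neq0; split=> //.
  apply/matrixP => k' l'; rewrite !mxE; apply: eqA.
  by apply: contraNneq SC_neq0 => ->; rewrite SC_ij.
by rewrite !mxE.
Qed.

Theorem corollary4p3 (R : realType) (q : nat) (n_ : 'I_q -> nat) (eps : R)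
    (GP GK GC : digraph q)
    (q_ge1 : (1 <= q)%N) (n_ge1 : forall i, (1 <= n_ i)%N) (eps_gt0 : 0 < eps)
    (GP_complete : GP = complete_graph q)
    (GK_complete : GK = complete_graph q)
    (GC_neq_GP : GC <> GP)
    (Gamma : blockmx R n_ -> blockmx R n_ -> blockmx R n_)
    (Gamma_in : design_methods eps (adjacency GP) (adjacency GK)
                  (adjacency GC) Gamma) :
  ((1 + 1 / eps ^+ 2)%:E <=
    competitive_ratio eps (adjacency GP) (adjacency GK) Gamma)%E.
Proof.
subst GP GK; have complete := @adjacency_complete q.
have [i [j SC_ij]] : exists i j, adjacency GC i j = 0%N.
  have /existsP[[j i] ji_notin] : [exists e, e \notin GC].
    rewrite -negb_forall; apply/negP => /forallP GC_full; apply: GC_neq_GP.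
    by apply/setP => e; rewrite GC_full inE.
  by exists i, j; rewrite mxE (negPf ji_notin).
pose a := tagnat.Rank i (Ordinal (n_ge1 i)).
pose b := tagnat.Rank j (Ordinal (n_ge1 j)).
(* The one entry of the gain that decides [x_a(1) = w + eps * gain w r]. *)
pose gain w r := Gamma (plantA (swap_plant eps a b w r)) eps%:M a b.
have row_outside j' k : j' != j -> tagnat.Rank j' k != b.
  move=> j'_neq; apply: contraNneq j'_neq => eq_b.
  by rewrite -(tagnat.Rank1K k) eq_b tagnat.Rank1K.
(* For [i != j] only [r], in row [b], is sure to be hidden, so [w] is kept; for [i = j] the only
   nonzero row is [a = b], and [w] is hidden too. *)
have gain_blind w r w' r' : (i != j -> w = w') -> gain w r = gain w' r'.
  move=> eq_w; apply: (blind_row Gamma_in complete SC_ij).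
    exact: scalar_input_matrix.
  move=> j' j'_neq k l; have [eq_ij|i_neq_j] := eqVneq i j; last first.
    by rewrite eq_w //; apply: swap_plantA_row; exact: row_outside.
  have k_neq_b := row_outside j' k j'_neq.
  have k_neq_a : tagnat.Rank j' k != a.
    by move: k_neq_b; rewrite /a /b; subst j.
  by rewrite !swap_plantA_row0.
set c := 1 + _.
have c_ge0 : 0 <= c by rewrite addr_ge0 // mul1r invr_ge0 sqr_ge0.
pose P w r : plant R n_ := swap_plant eps a b w r.
suff [w [r ratio_ge]] : exists w r,
    (c%:E <= cost_ratio (cost (P w r) (Gamma (plantA (P w r)) eps%:M))
      (cost (P w r)
         (optimal_controller (adjacency (complete_graph q)) (P w r))))%E.
  apply: le_trans ratio_ge _; apply: ereal_sup_ubound; exists (P w r) => //.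
  split; [exact: structured_complete | exact: scalar_input_matrix].
(* With denominators cleared, [amplified_ratio_ge] asks that [t] be at most the square of
   [w + eps * gain w r] if [i = j], of [r * (1 + eps * gain 1 r)] otherwise. *)
pose t := c / eps ^+ 2 * (1 + eps ^+ 2).
have e2_gt0 : 0 < eps ^+ 2 by rewrite exprn_gt0.
have den_gt0 : 0 < 1 + eps ^+ 2 by rewrite addr_gt0.
have t_ge0 : 0 <= t.
  by apply: mulr_ge0 (ltW den_gt0); exact: divr_ge0 c_ge0 (ltW e2_gt0).
(* Here [x >= 1], so [x <= x ^+ 2]; aiming at [t + 1] avoids the square root of [t]. *)
have le_sqr x : t + 1 <= x -> t <= x ^+ 2 by move=> ?; nra.
have [eq_ij|i_neq_j] := eqVneq i j.
  have eq_ab : a = b by rewrite /a /b; subst j.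
  (* The gain equals [gain 0 0] for every [w], and the absolute value absorbs it, leaving
     [w + eps * gain 0 0 >= t + 1]. *)
  pose w := t + 1 + `|eps * gain 0 0|.
  have w_gt0 : 0 < w by rewrite ltr_wpDr // ltr_wpDl.
  exists w, 0; apply: amplified_ratio_ge; rewrite ?lt0r_neq0 //.
  rewrite -/(gain _ _) (gain_blind _ _ 0 0) ?eq_ij ?eqxx // eq_ab eqxx.
  rewrite ler_pdivlMr // (_ : _ * _ = w ^+ 2 * t); last by rewrite /t; ring.
  rewrite ler_wpM2l ?sqr_ge0 //; apply: le_sqr.
  by rewrite /w -addrA lerDl -lerBlDr sub0r -normrN ler_norm.
have a_neq_b : a != b.
  apply: contraNneq i_neq_j => eq_ab.
  by rewrite -(tagnat.Rank1K (Ordinal (n_ge1 i))) -/a eq_ab tagnat.Rank1K.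
have [deadbeat|x_neq0] := eqVneq (1 + eps * gain 1 0) 0.
  by exists 1, 0; apply: deadbeat_ratio_ge.
(* This [r] makes [r * x_a(1) = t + 1]; the choice is not circular, since the gain does not depend
   on [r]. *)
exists 1, ((t + 1) / (1 + eps * gain 1 0)).
apply: amplified_ratio_ge; rewrite ?oner_neq0 //.
rewrite -/(gain _ _) (gain_blind _ _ 1 0) // (negPf a_neq_b).
rewrite -exprMn divfK // ler_pdivlMr // expr1n mul1r.
exact: le_sqr.
Qed.
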